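(* Let $\Bbbk$ be a field and let $A$ be a finite-dimensional semisimple $\Bbbk$-algebra with Frobenius trace form $\lambda$. Let $c_\lambda\in A\otimes_\Bbbk A$ be the Casimir element and $\gamma_\lambda$ the Casimir trace of $(A,\lambda)$. Let $\operatorname{Irr} A$ be a full set of representatives of the isomorphism classes of irreducible representations of $A$. Then $(c_\lambda)_{S,T}=0$ for all $S\neq T$ in $\operatorname{Irr}A$. If $S\in\operatorname{Irr}A$ is absolutely irreducible, then $$(\dim_\Bbbk S)^2\,(c_\lambda^2)_{S,S}=\gamma_\lambda(1)_S^2.$$
   Context: Algebras are associative and unital over the field $\Bbbk$; $\mathscr{Z}A$ is the center of $A$; $\langle\cdot,\cdot\rangle$ is the evaluation pairing $A^*\times A\to\Bbbk$, where $A^*=\operatorname{Hom}_\Bbbk(A,\Bbbk)$. A Frobenius (trace) form for a finite-dimensional algebra $A$ is a linear form $\lambda \in A^*$ with $\langle\lambda,ab\rangle=\langle\lambda,ba\rangle$ for all $a,b\in A$ that does not vanish on any nonzero ideal of $A$. The Casimir element of $(A,\lambda)$ is the unique element $c_\lambda=\sum_i x_i\otimes y_i \in A\otimes_\Bbbk A$ such that $a=\sum_i x_i\langle\lambda,ay_i\rangle$ for all $a\in A$; equivalently, one may take $\{x_i\}$ to be a $\Bbbk$-basis of $A$ and $\{y_i\}$ the basis with $\langle\lambda,x_iy_j\rangle=\delta_{i,j}$. The Casimir trace is the map $\gamma_\lambda\colon A\to \mathscr{Z}A$, $\gamma_\lambda(a)=\sum_i x_iay_i$. For $S\in\operatorname{Irr}A$,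 $D(S)=\operatorname{End}_A(S)$ and $a_S\in\operatorname{End}_{D(S)}(S)$ is the operator by which $a\in A$ acts on $S$. For $t\in A\otimes_\Bbbk A$ and $S,T\in\operatorname{Irr}A$, $t_{S,T}\in\operatorname{End}_{D(S)}(S)\otimes_\Bbbk\operatorname{End}_{D(T)}(T)$ denotes the image of $t$ under the algebra map determined by $(a\otimes b)_{S,T}=a_S\otimes b_T$. $S$ is absolutely irreducible if and only if $D(S)=\Bbbk$; in that case central elements of $A$, such as $\gamma_\lambda(1)$, act on $S$ by scalars, and the scalar $\gamma_\lambda(1)_S^2\in\Bbbk$ is identified with the corresponding scalar multiple of the identity in $\operatorname{End}_\Bbbk(S)\otimes_\Bbbk\operatorname{End}_\Bbbk(S)$. *)

(* Defs.v *)
From HB Require Import structures.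
From mathcomp Require Import all_boot all_order all_algebra all_field.

Set Implicit Arguments.
Unset Strict Implicit.
Unset Printing Implicit Defensive.

Import GRing.Theory.
Local Open Scope ring_scope.

(* Tensor product of finite-dimensional vector spaces, modelled by the matrix
   of coordinates in the basis of the e_i (x) e_j, for the bases provided by
   vbasis.  tens_lift_tens and tens_lift_unique are the universal property. *)

Definition tensor (K : fieldType) (V W : vectType K) : predArgType :=
  'M[K]_(\dim {:V}, \dim {:W}).

HB.instance Definition _ (K : fieldType) (V W : vectType K) :=
  Vector.copy (tensor V W) 'M[K]_(\dim {:V}, \dim {:W}).

Section Tensor.
Variables (K : fieldType) (V W : vectType K).

Definition tens (v : V) (w : W) : tensor V W :=
  \matrix_(i, j) (coord (vbasis {:V}) i v * coord (vbasis {:W}) j w).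

(* The value at t of the linear map determined by v (x) w |-> B v w. *)
Definition tens_lift (X : vectType K) (B : V -> W -> X) (t : tensor V W) : X :=
  \sum_i \sum_j (t : 'M_(_, _)) i j *: B (vbasis {:V})`_i (vbasis {:W})`_j.

Lemma tensPl k v1 v2 w :
  tens (k *: v1 + v2) w = k *: tens v1 w + tens v2 w.
Proof. by apply/matrixP=> i j; rewrite !mxE linearP /= mulrDl mulrA. Qed.

Lemma tensPr k v w1 w2 :
  tens v (k *: w1 + w2) = k *: tens v w1 + tens v w2.
Proof. by apply/matrixP=> i j; rewrite !mxE linearP /= mulrDr mulrCA. Qed.

Lemma tens_lift_is_linear (X : vectType K) (B : V -> W -> X) :
  linear (tens_lift B).
Proof.
move=> a t u; rewrite /tens_lift scaler_sumr -big_split /=; apply: eq_bigr => i _.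
rewrite scaler_sumr -big_split /=; apply: eq_bigr => j _.
by rewrite !mxE scalerDl scalerA.
Qed.

Lemma tens_lift_tens (X : vectType K) (B : V -> W -> X) v w :
    (forall w, linear (B^~ w)) -> (forall v, linear (B v)) ->
  tens_lift B (tens v w) = B v w.
Proof.
move=> Bl Br.
pose Lr v0 := GRing.isLinear.Build K W X _ (B v0) (Br v0).
pose gr v0 : {linear W -> X} := HB.pack (B v0) (Lr v0).
pose Ll w0 := GRing.isLinear.Build K V X _ (B^~ w0) (Bl w0).
pose gl w0 : {linear V -> X} := HB.pack (B^~ w0) (Ll w0).
rewrite [RHS](_ : _ = gl w v) // {2}(coord_vbasis (memvf v)) linear_sum /=.
apply: eq_bigr => i _; rewrite -[RHS]/(gl w _) linearZ /=.
rewrite -[B _ w]/(gr _ w) {2}(coord_vbasis (memvf w)) linear_sum scaler_sumr /=.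
by apply: eq_bigr => j _; rewrite -[B _ (_ *: _)]/(gr _ _) linearZ /= mxE scalerA.
Qed.

Lemma tens_span (t : tensor V W) :
  t = \sum_i \sum_j
        (t : 'M_(_, _)) i j *: tens (vbasis {:V})`_i (vbasis {:W})`_j.
Proof.
apply/matrixP=> k l; rewrite summxE (bigD1 k) //= summxE (bigD1 l) //=.
have fV := basis_free (vbasisP {:V}); have fW := basis_free (vbasisP {:W}).
rewrite !mxE !coord_free // !eqxx !mulr1 !big1 ?addr0 //.
  move=> i /negPf ik; rewrite summxE big1 // => j _.
  by rewrite !mxE !coord_free // ik mul0r mulr0.
by move=> j /negPf jl; rewrite !mxE !coord_free // jl !mulr0.
Qed.

Lemma tens_ind (P : tensor V W -> Prop) :
    (forall v w, P (tens v w)) ->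
    (forall k t u, P t -> P u -> P (k *: t + u)) ->
  forall t, P t.
Proof.
move=> Pt Plin t; have P0 : P 0.
  rewrite -(_ : tens 0 0 = 0) //.
  by apply/matrixP=> i j; rewrite !mxE linear0 mul0r.
have PD u v : P u -> P v -> P (u + v).
  by move=> Pu Pv; rewrite -[u]scale1r; apply: Plin.
rewrite (tens_span t); apply: (big_ind P) => // i _.
apply: (big_ind P) => // j _.
by rewrite -[_ *: _]addr0; apply: Plin.
Qed.

Lemma tens_lift_unique (X : vectType K) (f g : {linear tensor V W -> X}) :
  (forall v w, f (tens v w) = g (tens v w)) -> f =1 g.
Proof.
by move=> fg; elim/tens_ind=> // k t u IHt IHu; rewrite !linearP IHt IHu.
Qed.

HB.instance Definition _ (X : vectType K) (B : V -> W -> X) :=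
  GRing.isLinear.Build K (tensor V W) X _ (tens_lift B)
    (tens_lift_is_linear B).

End Tensor.

Section TensorAlgebra.
Variables (K : fieldType) (A B : falgType K).
Local Notation AB := (tensor A B).

Definition tens_mul (t u : AB) : AB :=
  tens_lift (fun a b => tens_lift (fun a' b' => tens (a * a') (b * b')) u) t.

Definition tens_one : AB := tens 1 1.

Lemma tens_mull_is_linear t : linear (tens_mul t).
Proof.
move=> k u v; rewrite /tens_mul {1 3 5}/tens_lift scaler_sumr -big_split /=.
apply: eq_bigr => i _; rewrite scaler_sumr -big_split /=; apply: eq_bigr => j _.
by rewrite linearP /= scalerDr !scalerA mulrC.
Qed.

Lemma tens_mulPr k t u v :
  tens_mul t (k *: u + v) = k *: tens_mul t u + tens_mul t v.
Proof. exact: tens_mull_is_linear. Qed.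

Lemma tens_mulPl k t u v :
  tens_mul (k *: t + u) v = k *: tens_mul t v + tens_mul u v.
Proof. by rewrite /tens_mul linearP. Qed.

Lemma tens_mulE a b a' b' :
  tens_mul (tens a b) (tens a' b') = tens (a * a') (b * b').
Proof.
rewrite /tens_mul tens_lift_tens /= => [|y k x1 x2|x k y1 y2].
- rewrite tens_lift_tens // => [y k x1 x2|x k y1 y2].
    by rewrite mulrDr -scalerAr tensPl.
  by rewrite mulrDr -scalerAr tensPr.
- rewrite /tens_lift scaler_sumr -big_split; apply: eq_bigr => i _ /=.
  rewrite scaler_sumr -big_split; apply: eq_bigr => j _ /=.
  by rewrite mulrDl -scalerAl tensPl scalerDr !scalerA [k * _]mulrC.
- rewrite /tens_lift scaler_sumr -big_split; apply: eq_bigr => i _ /=.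
  rewrite scaler_sumr -big_split; apply: eq_bigr => j _ /=.
  by rewrite mulrDl -scalerAl tensPr scalerDr !scalerA [k * _]mulrC.
Qed.

Lemma tens_mulA : associative tens_mul.
Proof.
move=> t u v; elim/tens_ind: t => [a b|k t t' IH IH']; last first.
  by rewrite !tens_mulPl IH IH'.
elim/tens_ind: u => [a' b'|k u u' IH IH']; last first.
  by rewrite !(tens_mulPl, tens_mulPr) IH IH'.
elim/tens_ind: v => [a'' b''|k v v' IH IH']; last first.
  by rewrite !tens_mulPr IH IH'.
by rewrite !tens_mulE !mulrA.
Qed.

Lemma tens_mul1r : left_id tens_one tens_mul.
Proof.
elim/tens_ind=> [a b|k t u IHt IHu]; last by rewrite tens_mulPr IHt IHu.
by rewrite tens_mulE !mul1r.
Qed.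

Lemma tens_mulr1 : right_id tens_one tens_mul.
Proof.
elim/tens_ind=> [a b|k t u IHt IHu]; last by rewrite tens_mulPl IHt IHu.
by rewrite tens_mulE !mulr1.
Qed.

Lemma tens_mulDl : left_distributive tens_mul +%R.
Proof. by move=> t u v; rewrite -[t]scale1r tens_mulPl !scale1r. Qed.

Lemma tens_mulDr : right_distributive tens_mul +%R.
Proof. by move=> t u v; rewrite -[u]scale1r tens_mulPr !scale1r. Qed.

Lemma tens_scalerAl k (t u : AB) : k *: tens_mul t u = tens_mul (k *: t) u.
Proof. by rewrite /tens_mul linearZ. Qed.

Lemma tens_scalerAr k (t u : AB) : k *: tens_mul t u = tens_mul t (k *: u).
Proof.
pose L := GRing.isLinear.Build K AB AB _ (tens_mul t) (tens_mull_is_linear t).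
pose f : {linear AB -> AB} := HB.pack (tens_mul t) L.
by rewrite -[RHS]/(f _) linearZ.
Qed.

Lemma tens_one_neq0 : tens_one != 0.
Proof.
have nz (C : falgType K) : exists i, coord (vbasis {:C}) i 1 != 0.
  apply/existsP; apply: contraT; rewrite negb_exists => /forallP c0.
  case/negP: (oner_neq0 C); rewrite (coord_vbasis (memvf 1)) big1 // => i _.
  by move/negbNE/eqP: (c0 i) => ->; rewrite scale0r.
have [[i iP] [j jP]] := (nz A, nz B).
apply/eqP => /matrixP/(_ i j); rewrite !mxE => /eqP.
by rewrite mulf_eq0 (negPf iP) (negPf jP).
Qed.

HB.instance Definition _ := GRing.Zmodule_isNzRing.Build AB
  tens_mulA tens_mul1r tens_mulr1 tens_mulDl tens_mulDr tens_one_neq0.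
HB.instance Definition _ :=
  GRing.Lmodule_isLalgebra.Build K AB tens_scalerAl.
HB.instance Definition _ := GRing.Lalgebra_isAlgebra.Build K AB tens_scalerAr.
HB.instance Definition _ := Algebra_isFalgebra.Build K AB.

End TensorAlgebra.

Section Frobenius.
Variables (K : fieldType) (A : falgType K).

Definition is_ideal (I : {vspace A}) : Prop :=
  forall a x, x \in I -> (a * x \in I) /\ (x * a \in I).

Definition frobenius_form (lambda : {scalar A}) : Prop :=
  (forall a b, lambda (a * b) = lambda (b * a)) /\
  (forall I : {vspace A}, is_ideal I -> (forall x, x \in I -> lambda x = 0) ->
     I = 0%VS).

(* c = \sum_i x_i (x) y_i satisfies a = \sum_i lambda(a y_i) x_i for all a;
   there is exactly one such c, see casimir_exists and casimir_unique. *)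
Definition is_casimir (lambda : {scalar A}) (c : tensor A A) : Prop :=
  forall a, a = tens_lift (fun x y => lambda (a * y) *: x) c.

Lemma casimirE lambda c : is_casimir lambda c <->
  forall a i, coord (vbasis {:A}) i a
    = lambda (a * \sum_j (c : 'M_(_, _)) i j *: (vbasis {:A})`_j).
Proof.
have fA := basis_free (vbasisP {:A}).
have E a i : coord (vbasis {:A}) i (tens_lift (fun x y => lambda (a * y) *: x) c)
    = lambda (a * \sum_j (c : 'M_(_, _)) i j *: (vbasis {:A})`_j).
  rewrite /tens_lift.
  under eq_bigr => k _ do under eq_bigr => j _ do rewrite scalerA.
  under eq_bigr => k _ do rewrite -scaler_suml.
  rewrite coord_sum_free // mulr_sumr linear_sum; apply: eq_bigr => j _.
  by rewrite -scalerAr linearZ.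
split=> H a => [i|]; first by rewrite {1}(H a) E.
rewrite {1}(coord_vbasis (memvf a)) [RHS](coord_vbasis (memvf _)).
by apply: eq_bigr => i _; rewrite E H.
Qed.

Lemma frobenius_nondegenerate lambda y :
  frobenius_form lambda -> (forall a, lambda (a * y) = 0) -> y = 0.
Proof.
case=> lamC lamI y0.
have lin b : linear (fun x : A => lambda (x * b) *: (1 : A)).
  by move=> k u v; rewrite mulrDl -scalerAl linearP scalerDl /= scalerA.
pose L b := GRing.isLinear.Build K A A _ _ (lin b).
pose h b : {linear A -> A} := HB.pack (fun x : A => lambda (x * b) *: (1 : A)) (L b).
pose I := (\bigcap_(i < \dim {:A}) lker (linfun (h (vbasis {:A})`_i)))%VS.
have memI x : reflect (forall b, lambda (x * b) = 0) (x \in I).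
  have memk b : (x \in lker (linfun (h b))) = (lambda (x * b) == 0).
    by rewrite memv_ker lfunE /= scaler_eq0 oner_eq0 orbF.
  apply: (iffP idP) => [xI b | xb]; last first.
    by rewrite memvE; apply/subv_bigcapP => i _; rewrite -memvE memk xb.
  have /subv_bigcapP xIi : (<[x]> <= I)%VS by rewrite -memvE.
  rewrite (coord_vbasis (memvf b)) mulr_sumr linear_sum big1 // => i _.
  rewrite -scalerAr linearZ /=.
  by have := xIi i isT; rewrite -memvE memk => /eqP->; rewrite mulr0.
apply/eqP; rewrite -memv0 -(lamI I) => [|a x /memI xI|x /memI/(_ 1)].
- by apply/memI => b; rewrite lamC y0.
- split; apply/memI => b; last by rewrite -mulrA xI.
  by rewrite -mulrA lamC -mulrA xI.
- by rewrite mulr1.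
Qed.

Lemma casimir_unique lambda c c' : frobenius_form lambda ->
  is_casimir lambda c -> is_casimir lambda c' -> c = c'.
Proof.
move=> fl /casimirE cE /casimirE c'E; apply/matrixP => i j.
have fA := basis_free (vbasisP {:A}).
have: \sum_j (c : 'M_(_, _)) i j *: (vbasis {:A})`_j
    = \sum_j (c' : 'M_(_, _)) i j *: (vbasis {:A})`_j.
  apply/eqP; rewrite -subr_eq0; apply/eqP/(frobenius_nondegenerate fl) => a.
  by rewrite mulrBr linearB /= -cE -c'E subrr.
by move/(congr1 (coord (vbasis {:A}) j)); rewrite !coord_sum_free.
Qed.

Lemma casimir_exists lambda :
  frobenius_form lambda -> exists c, is_casimir lambda c.
Proof.
move=> fl; have fA := basis_free (vbasisP {:A}).
pose e := (vbasis {:A}).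
pose G : 'M[K]_(\dim {:A}) := \matrix_(j, k) lambda (e`_k * e`_j).
have Gu : G \in unitmx.
  rewrite -row_free_unit; apply: inj_row_free => v vG.
  have y0 : \sum_j v 0 j *: e`_j = 0.
    apply: (frobenius_nondegenerate fl) => a.
    rewrite (coord_vbasis (memvf a)) mulr_suml linear_sum big1 // => k _.
    rewrite -scalerAl linearZ /= mulr_sumr linear_sum.
    have /rowP/(_ k) := vG; rewrite !mxE => vGk.
    rewrite (_ : \sum_i _ = 0) ?mulr0 // -[RHS]vGk; apply: eq_bigr => j _.
    by rewrite !mxE -scalerAr linearZ.
  apply/rowP => j; rewrite mxE.
  by have := congr1 (coord e j) y0; rewrite coord_sum_free ?linear0.
exists (invmx G); apply/casimirE => a i.
rewrite {2}(coord_vbasis (memvf a)) mulr_suml linear_sum.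
under eq_bigr => k _.
  rewrite -scalerAl linearZ /= mulr_sumr linear_sum /=.
  rewrite (_ : \sum_j _ = (i == k)%:R); first over.
  have /matrixP/(_ i k) := mulVmx Gu; rewrite !mxE => <-.
  by apply: eq_bigr => j _; rewrite !mxE -scalerAr linearZ.
rewrite (bigD1 i) //= eqxx mulr1 big1 ?addr0 // => k /negPf ki.
by rewrite eq_sym ki mulr0.
Qed.

(* \sum_i x_i a y_i if c = \sum_i x_i (x) y_i. *)
Definition casimir_trace (c : tensor A A) (a : A) : A :=
  tens_lift (fun x y => x * a * y) c.

End Frobenius.

Section Representations.
Variables (K : fieldType) (A : falgType K).

Record rep := Rep {
  rep_space :> vectType K;
  rep_act : {linear A -> 'End(rep_space)};
  rep_act1 : rep_act 1 = \1%VF;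
  rep_actM : forall a b, rep_act (a * b) = (rep_act a \o rep_act b)%VF
}.

Definition subrep (V : rep) (U : {vspace V}) : Prop :=
  forall a, (rep_act V a @: U <= U)%VS.

Definition irreducible_subrep (V : rep) (U : {vspace V}) : Prop :=
  [/\ subrep U, U != 0%VS &
      forall U' : {vspace V}, subrep U' -> (U' <= U)%VS -> U' = 0%VS \/ U' = U].

Definition irreducible_rep (V : rep) : Prop := irreducible_subrep {:V}%VS.

Definition completely_reducible (V : rep) : Prop :=
  exists (n : nat) (U : 'I_n -> {vspace V}),
    [/\ forall i, irreducible_subrep (U i), directv (\sum_i U i) &
        (\sum_i U i)%VS = {:V}%VS].

Definition rep_iso (V W : rep) : Prop :=
  exists f : 'Hom(V, W),
    bijective f /\ forall a, (f \o rep_act V a)%VF = (rep_act W a \o f)%VF.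

Definition full_irr_set (Irr : rep -> Prop) : Prop :=
  [/\ forall S, Irr S -> irreducible_rep S,
      forall V, irreducible_rep V -> exists2 S, Irr S & rep_iso V S &
      forall S T, Irr S -> Irr T -> rep_iso S T -> S = T].

Definition regular_rep : rep :=
  @Rep A (@amull K A) (amull1 A) (fun a b => amullM a b).

Definition semisimple_alg : Prop := completely_reducible regular_rep.

End Representations.

Section Bicommutant.
Variables (K : fieldType) (V : vectType K).

Definition lfun_commutant (X : seq 'End(V)) : {vspace 'End(V)} :=
  (\bigcap_(f <- X)
     lker (linfun (fun g : 'End(V) => ((f \o g) - (g \o f))%VF)))%VS.

Lemma lfun_commutantP X g :
  reflect (forall f, f \in X -> (f \o g)%VF = (g \o f)%VF)
          (g \in lfun_commutant X).
Proof.
have lin (f : 'End(V)) :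
    linear (fun g : 'End(V) => ((f \o g) - (g \o f))%VF).
  move=> a u v; rewrite comp_lfunDr comp_lfunDl -comp_lfunZr -comp_lfunZl.
  by rewrite scalerBr opprD addrACA.
have mem1 f : (g \in lker (linfun (fun g : 'End(V) => ((f \o g) - (g \o f))%VF)))
      = ((f \o g)%VF == (g \o f)%VF).
  pose L := GRing.isLinear.Build K 'End(V) 'End(V) _ _ (lin f).
  pose h : {linear 'End(V) -> 'End(V)} :=
    HB.pack (fun g : 'End(V) => ((f \o g) - (g \o f))%VF) L.
  by rewrite memv_ker (lfunE h) /= subr_eq0.
rewrite /lfun_commutant; elim: X => [|f X IH].
  by rewrite big_nil memvf; apply: ReflectT.
rewrite big_cons memv_cap mem1; apply: (iffP andP) => [[/eqP fg /IH gX] f'|H].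
  by rewrite inE => /predU1P[->|/gX].
split; first by apply/eqP/H; rewrite mem_head.
by apply/IH => f' f'X; apply: H; rewrite inE f'X orbT.
Qed.

End Bicommutant.

Section DivisionAlgebra.
Variables (K : fieldType) (A : falgType K).

Definition end_alg (S : rep A) : {vspace 'End(S)} :=
  lfun_commutant [seq rep_act S a | a <- vbasis {:A}].

Lemma end_algP (S : rep A) (g : 'End(S)) :
  reflect (forall a, (rep_act S a \o g)%VF = (g \o rep_act S a)%VF)
          (g \in end_alg S).
Proof.
apply: (iffP (lfun_commutantP _ _)) => [H a | H f /mapP[a _ ->] //].
apply/lfunP=> v; rewrite !comp_lfunE (coord_vbasis (memvf a)) linear_sum.
rewrite !sum_lfunE linear_sum; apply: eq_bigr => i _.
rewrite linearZ /= !scale_lfunE linearZ /=; congr (_ *: _).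
by rewrite -!comp_lfunE H // map_f // memt_nth.
Qed.

Definition biend_alg (S : rep A) : {vspace 'End(S)} :=
  lfun_commutant (vbasis (end_alg S)).

Lemma biend_algP (S : rep A) (g : 'End(S)) :
  reflect (forall f, f \in end_alg S -> (f \o g)%VF = (g \o f)%VF)
          (g \in biend_alg S).
Proof.
apply: (iffP (lfun_commutantP _ _)) => [H f fD | H f fX]; last first.
  by apply: H; apply: vbasis_mem.
apply/lfunP=> v; rewrite !comp_lfunE (coord_vbasis fD) !sum_lfunE linear_sum.
apply: eq_bigr => i _; rewrite !scale_lfunE linearZ /=; congr (_ *: _).
by rewrite -!comp_lfunE H // memt_nth.
Qed.

Lemma rep_act_biend (S : rep A) a : rep_act S a \in biend_alg S.
Proof. by apply/biend_algP => f /end_algP ->. Qed.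

Lemma id_biend (S : rep A) : \1%VF \in biend_alg S.
Proof. by rewrite -(rep_act1 S) rep_act_biend. Qed.

(* The algebra End_{D(S)}(S), as a vector space. *)
Definition biend (S : rep A) : vectType K := subvs_of (biend_alg S).

(* The operator a_S, as an element of End_{D(S)}(S). *)
Definition act_biend (S : rep A) (a : A) : biend S :=
  Subvs (rep_act_biend S a).

Definition biend_id (S : rep A) : biend S := Subvs (id_biend S).

Definition tens_act (S T : rep A) (t : tensor A A) :
    tensor (biend S) (biend T) :=
  tens_lift (fun a b => tens (act_biend S a) (act_biend T b)) t.

Lemma tens_actE (S T : rep A) a b :
  tens_act S T (tens a b) = tens (act_biend S a) (act_biend T b).
Proof.
have actP (U : rep A) k a1 a2 :
    act_biend U (k *: a1 + a2) = k *: act_biend U a1 + act_biend U a2.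
  by apply/val_inj; rewrite /= linearP.
by rewrite /tens_act tens_lift_tens // => [y|x] k u v; rewrite actP (tensPl, tensPr).
Qed.

(* end_alg S is D(S); the second condition says D(S) = K. *)
Definition absolutely_irreducible (S : rep A) : Prop :=
  irreducible_rep S /\ end_alg S = <[\1%VF]>%VS.

End DivisionAlgebra.

(* Main.v *)
(* Write c = \sum_k x_k (x) y_k.  The defining property of c gives
   (b (x) 1) c = c (1 (x) b) and (1 (x) b) c = c (b (x) 1) for all b in A.
   If S and T are not isomorphic, summing the components of 1 in those minimal
   left ideals of A that do not annihilate S gives e acting as 1 on S and as 0
   on T, so c_{S,T} = ((e (x) 1) c)_{S,T} = (c (1 (x) e))_{S,T} = 0.
   If D(S) = K, a minimal left ideal not annihilating S acts by all rank one
   operators phi(.) v for some fixed phi, and the two relations above force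
   c_{S,S} = kappa . swap, where swap is the exchange operator of S (x) S.
   Hence c^2 acts as kappa^2, and contraction gives
   gamma(1)_S = kappa . dim S. *)
Require Import Defs.
From HB Require Import structures.
From mathcomp Require Import all_boot all_order all_algebra all_field.

Set Implicit Arguments.
Unset Strict Implicit.
Unset Printing Implicit Defensive.

Import GRing.Theory.
Local Open Scope ring_scope.

(** * Linear maps, coordinates and sums of pure tensors *)

Lemma lfun_neq0P (K : fieldType) (V W : vectType K) (f : 'Hom(V, W)) :
  f != 0 -> exists v, f v != 0.
Proof.
move=> f0; have [/existsP[i fi]|] :=
  boolP [exists i : 'I_(\dim {:V}), f (vbasis {:V})`_i != 0].
  by exists (vbasis {:V})`_i.
rewrite negb_exists => /forallP fb; case/negP: f0; apply/eqP/lfunP => v.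
rewrite (coord_vbasis (memvf v)) linear_sum big1 ?lfunE // => i _.
by rewrite linearZ /=; move/negbNE/eqP: (fb i) => ->; rewrite scaler0.
Qed.

Lemma coord_inj (K : fieldType) (V : vectType K) (u v : V) :
  (forall i, coord (vbasis {:V}) i u = coord (vbasis {:V}) i v) -> u = v.
Proof.
move=> uv; rewrite (coord_vbasis (memvf u)) (coord_vbasis (memvf v)).
by apply: eq_bigr => i _; rewrite uv.
Qed.

(** Lets the Casimir element be handled as a sum of [tens (x k) (y k)]; the witnesses are the chosen
    basis of [V] and the rows of [t]. *)
Lemma tens_sumE (K : fieldType) (V W : vectType K) (t : tensor V W) :
  exists n (x : 'I_n -> V) (y : 'I_n -> W), t = \sum_k tens (x k) (y k).
Proof.
exists _, (fun i => (vbasis {:V})`_i),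
  (fun i => \sum_j (t : 'M_(_, _)) i j *: (vbasis {:W})`_j).
rewrite {1}(tens_span t); apply: eq_bigr => i _.
pose L := GRing.isLinear.Build K W (tensor V W) _ (tens (vbasis {:V})`_i)
  (fun k => tensPr k _).
pose f : {linear W -> tensor V W} := HB.pack (tens (vbasis {:V})`_i) L.
rewrite -[RHS]/(f _) linear_sum; apply: eq_bigr => j _; by rewrite linearZ.
Qed.

Lemma tens_suml (K : fieldType) (V W : vectType K) n (v : 'I_n -> V)
    (a : 'I_n -> K) (w : W) :
  tens (\sum_i a i *: v i) w = \sum_i a i *: tens (v i) w.
Proof.
pose L := GRing.isLinear.Build K V (tensor V W) _ (fun v => tens v w)
  (fun k v1 v2 => tensPl k v1 v2 w).
pose f : {linear V -> tensor V W} := HB.pack (fun v : V => tens v w) L.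
by rewrite -[LHS]/(f _) linear_sum; apply: eq_bigr => j _; rewrite linearZ.
Qed.

Lemma tens_sumr (K : fieldType) (V W : vectType K) n (v : V)
    (a : 'I_n -> K) (w : 'I_n -> W) :
  tens v (\sum_i a i *: w i) = \sum_i a i *: tens v (w i).
Proof.
pose L := GRing.isLinear.Build K W (tensor V W) _ (tens v)
  (fun k => tensPr k v).
pose f : {linear W -> tensor V W} := HB.pack (tens v) L.
by rewrite -[LHS]/(f _) linear_sum; apply: eq_bigr => j _; rewrite linearZ.
Qed.

Lemma tens_lift_sum (K : fieldType) (V W X : vectType K) (B : V -> W -> X)
    n (x : 'I_n -> V) (y : 'I_n -> W) :
    (forall w, linear (B^~ w)) -> (forall v, linear (B v)) ->
  tens_lift B (\sum_k tens (x k) (y k)) = \sum_k B (x k) (y k).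
Proof.
move=> Bl Br; rewrite linear_sum; apply: eq_bigr => k _.
exact: tens_lift_tens.
Qed.

(** * Dual expansions and sliding identities for the Casimir element *)

Section Casimir.
Variables (K : fieldType) (A : falgType K) (lambda : {scalar A}) (n : nat).
Variables (x y : 'I_n -> A).
Hypothesis frob : frobenius_form lambda.
Hypothesis casi : is_casimir lambda (\sum_k tens (x k) (y k)).

Lemma casimir_suml a : a = \sum_k lambda (a * y k) *: x k.
Proof.
rewrite {1}(casi a) tens_lift_sum // => [w k u v|v k u w].
  by rewrite scalerDr !scalerA mulrC.
by rewrite mulrDr -scalerAr linearP scalerDl /= scalerA.
Qed.

(** By nondegeneracy it suffices to pair both sides with every [a]; expanding [a] by [casimir_suml]
    then yields the same sum twice. *)
Lemma casimir_sumr b : b = \sum_k lambda (x k * b) *: y k.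
Proof.
apply/eqP; rewrite -subr_eq0; apply/eqP/(frobenius_nondegenerate frob) => a.
rewrite mulrBr linearB /= {1}(casimir_suml a) mulr_suml mulr_sumr !linear_sum.
apply/eqP; rewrite subr_eq0; apply/eqP; apply: eq_bigr => k _.
by rewrite -scalerAl -scalerAr !linearZ /= mulrC.
Qed.

(** Expanding [b * x k] in the [x l] and [y k * b] in the [y l], the coefficients of
    [tens (x l) (y k)] are lambda(b x_k y_l) and lambda(x_k y_l b), which agree by the trace
    property. *)
Lemma casimir_outer b :
  \sum_k tens (b * x k) (y k) = \sum_k tens (x k) (y k * b).
Proof.
under eq_bigr => k _ do rewrite [b * _]casimir_suml tens_suml.
under [RHS]eq_bigr => k _ do rewrite [_ * b]casimir_sumr tens_sumr.
rewrite exchange_big; apply: eq_bigr => k _; apply: eq_bigr => l _.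
by rewrite -mulrA frob.1 mulrA.
Qed.

(** The same comparison, where associativity alone matches the coefficients. *)
Lemma casimir_inner b :
  \sum_k tens (x k * b) (y k) = \sum_k tens (x k) (b * y k).
Proof.
under eq_bigr => k _ do rewrite [_ * b]casimir_suml tens_suml.
under [RHS]eq_bigr => k _ do rewrite [b * _]casimir_sumr tens_sumr.
rewrite exchange_big; apply: eq_bigr => k _; apply: eq_bigr => l _.
by rewrite -mulrA.
Qed.

Lemma casimir_bilin_outer (X : vectType K) (B : A -> A -> X) b :
    (forall w, linear (B^~ w)) -> (forall v, linear (B v)) ->
  \sum_k B (b * x k) (y k) = \sum_k B (x k) (y k * b).
Proof.
by move=> Bl Br; have := congr1 (tens_lift B) (casimir_outer b);
   rewrite !tens_lift_sum.
Qed.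

Lemma casimir_bilin_inner (X : vectType K) (B : A -> A -> X) b :
    (forall w, linear (B^~ w)) -> (forall v, linear (B v)) ->
  \sum_k B (x k * b) (y k) = \sum_k B (x k) (b * y k).
Proof.
by move=> Bl Br; have := congr1 (tens_lift B) (casimir_inner b);
   rewrite !tens_lift_sum.
Qed.

End Casimir.

(** * Minimal left ideals acting on irreducible representations *)

Section MinimalLeftIdeal.
Variables (K : fieldType) (A : falgType K).

Lemma rep_actME (S : rep A) a b s :
  rep_act S (a * b) s = rep_act S a (rep_act S b s).
Proof. by rewrite rep_actM comp_lfunE. Qed.

Definition orbit (S : rep A) (s : S) (a : A) : S := rep_act S a s.

Lemma orbit_is_linear (S : rep A) (s : S) : linear (orbit s).
Proof. by move=> k a b; rewrite /orbit linearP /= add_lfunE scale_lfunE. Qed.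

HB.instance Definition _ (S : rep A) (s : S) :=
  GRing.isLinear.Build K A S _ (orbit s) (orbit_is_linear s).

Definition orbit_map (S : rep A) (s : S) : 'Hom(A, S) := linfun (orbit s).

Lemma orbit_mapE (S : rep A) (s : S) a : orbit_map s a = rep_act S a s.
Proof. by rewrite lfunE. Qed.

Variables (U : {vspace A}) (S : rep A) (s : S).
Hypothesis minU : irreducible_subrep (V := regular_rep A) U.
Hypothesis irrS : irreducible_rep S.
Hypothesis Us : exists2 u, u \in U & rep_act S u s != 0.

Lemma minimal_ideal_mull a u : u \in U -> a * u \in U.
Proof.
move=> uU; have [/(_ a)/subvP sU _ _] := minU.
by have := sU _ (memv_img (amull a) uU); rewrite lfunE.
Qed.

(** Schur's argument: the annihilator of [s] in [U] is a left ideal, hence 0 or [U], and [Us]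
    excludes [U]. *)
Lemma orbit_inj u : u \in U -> rep_act S u s = 0 -> u = 0.
Proof.
move=> uU us0; have [_ _ minU'] := minU.
have [a||kU|kU] := minU' (U :&: lker (orbit_map s))%VS.
- apply/subvP => _ /memv_imgP[w /memv_capP[wU wk] ->].
  rewrite lfunE /= memv_cap minimal_ideal_mull //= memv_ker orbit_mapE.
  by move: wk; rewrite memv_ker orbit_mapE rep_actME => /eqP ->; rewrite linear0.
- exact: capvSl.
- by apply/eqP; rewrite -memv0 -kU memv_cap uU memv_ker orbit_mapE us0 eqxx.
case: Us => w wU /negP[].
by move: wU; rewrite -kU memv_cap memv_ker orbit_mapE => /andP[].
Qed.

(** The image U s is a subrepresentation of the irreducible [S], nonzero by [Us]. *)
Lemma orbit_surj v : exists2 u, u \in U & rep_act S u s = v.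
Proof.
have [_ _ minS] := irrS.
have [a||kU|kU] := minS (orbit_map s @: U)%VS.
- apply/subvP => _ /memv_imgP[_ /memv_imgP[w wU ->] ->].
  by rewrite orbit_mapE -rep_actME -orbit_mapE memv_img ?minimal_ideal_mull.
- exact: subvf.
- case: Us => w wU /negP[].
  by rewrite -memv0 -kU -orbit_mapE memv_img.
have := memvf v; rewrite -kU => /memv_imgP[u uU ->].
by exists u; rewrite ?orbit_mapE.
Qed.

(** As u -> u s is a bijection from [U] onto [S], the rule u s -> u t is well defined for any [t],
    and it commutes with left multiplication. *)
Lemma orbit_transfer (T : rep A) (t : T) :
  exists2 G : 'Hom(S, T),
    forall a, (G \o rep_act S a)%VF = (rep_act T a \o G)%VF &
    forall u, u \in U -> G (rep_act S u s) = rep_act T u t.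
Proof.
(* [f] extends the orbit map from [U] to [A] by projection; [(f^-1)%VF] chooses some preimage, whose
   component in [U] is unique by [orbit_inj]. *)
pose f := (orbit_map s \o projv U)%VF.
pose G := (orbit_map t \o projv U \o f^-1)%VF.
have GU u : u \in U -> G (rep_act S u s) = rep_act T u t.
  move=> uU; rewrite /G !comp_lfunE orbit_mapE; congr (rep_act T _ t).
  set w := projv U _; have wU : w \in U by apply: memv_proj.
  have fw : f ((f^-1)%VF (rep_act S u s)) = rep_act S u s.
    apply: limg_lfunVK; rewrite -{1}(projv_id uU) -orbit_mapE.
    by rewrite -[orbit_map s _]comp_lfunE memv_img ?memvf.
  apply/eqP; rewrite -subr_eq0; apply/eqP/orbit_inj; first exact: memvB.
  move: fw; rewrite /f comp_lfunE orbit_mapE => fw.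
  by rewrite linearB add_lfunE opp_lfunE fw subrr.
exists G => // a; apply/lfunP => v; rewrite [LHS]comp_lfunE [RHS]comp_lfunE.
have [u uU <-] := orbit_surj v.
rewrite (GU _ uU) -rep_actME GU ?minimal_ideal_mull //.
  by rewrite rep_actME.
Qed.

End MinimalLeftIdeal.

(** * Separating elements and rank one operators in a semisimple algebra *)

Section Semisimple.
Variables (K : fieldType) (A : falgType K).
Hypothesis ssA : semisimple_alg A.

Lemma one_minimal_ideals :
  exists n (U : 'I_n -> {vspace A}) (u : 'I_n -> A),
    [/\ forall i, irreducible_subrep (V := regular_rep A) (U i),
        forall i, u i \in U i & 1 = \sum_i u i].
Proof.
have [n [U [minU _ sumU]]] := ssA.
have /memv_sumP[u uU ->] : (1 : A) \in (\sum_i U i)%VS by rewrite sumU memvf.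
by exists n, U, u; split=> // i; apply: uU.
Qed.

(** The transfers u s -> u t and u t -> u s are mutually inverse. *)
Lemma minimal_ideal_iso (S T : rep A) (U : {vspace A}) (s : S) (t : T) :
    irreducible_subrep (V := regular_rep A) U ->
    irreducible_rep S -> irreducible_rep T ->
    (exists2 u, u \in U & rep_act S u s != 0) ->
    (exists2 u, u \in U & rep_act T u t != 0) ->
  rep_iso S T.
Proof.
move=> minU irrS irrT Us Ut.
have [G Ghom GU] := orbit_transfer minU irrS Us t.
have [H _ HU] := orbit_transfer minU irrT Ut s.
exists G; split=> //; exists H => v.
  by have [u uU <-] := orbit_surj minU irrS Us v; rewrite GU ?HU.
by have [u uU <-] := orbit_surj minU irrT Ut v; rewrite HU ?GU.
Qed.

Lemma separating_element (S T : rep A) :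
    irreducible_rep S -> irreducible_rep T -> ~ rep_iso S T ->
  exists e, rep_act S e = \1%VF /\ rep_act T e = 0.
Proof.
move=> irrS irrT nST; have [n [U [u [minU uU u1]]]] := one_minimal_ideals.
(* [P i] says that [U i] annihilates [S]; such components contribute nothing to the action of 1 on
   [S]. *)
pose P i := (U i <= lker (linfun (rep_act S)))%VS.
have memk a : (a \in lker (linfun (rep_act S))) = (rep_act S a == 0).
  by rewrite memv_ker lfunE.
exists (\sum_(i | ~~ P i) u i); split.
  rewrite -(rep_act1 S) u1 [in RHS](bigID P) /= linearD /=.
  rewrite [X in _ = X + _](_ : _ = 0) ?add0r //.
  rewrite linear_sum big1 // => i /subvP Pi.
  by apply/eqP; rewrite -memk Pi.
(* If a remaining [u i] acted nontrivially on [T], the ideal [U i] would annihilate neither [S] nor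
   [T] and force an isomorphism. *)
rewrite linear_sum big1 // => i /subvPn[w wU].
rewrite memk => /lfun_neq0P[s ws].
apply/lfunP => t; rewrite lfunE; have [//|ut] := eqVneq (rep_act T (u i) t) 0.
by case: nST; apply: (@minimal_ideal_iso _ _ (U i) s t) => //;
   [exists w|exists (u i)].
Qed.

Lemma minimal_ideal_acts (S : rep A) (s : S) : s != 0 ->
  exists2 U : {vspace A}, irreducible_subrep (V := regular_rep A) U &
    exists2 u, u \in U & rep_act S u s != 0.
Proof.
move=> s0; have [n [U [u [minU uU u1]]]] := one_minimal_ideals.
have [/existsP[i us]|] := boolP [exists i, rep_act S (u i) s != 0].
  by exists (U i) => //; exists (u i).
rewrite negb_exists => /forallP us0; case/negP: s0.
rewrite -[s]id_lfunE -(rep_act1 S) u1 linear_sum sum_lfunE big1 // => i _.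
exact/eqP/negbNE.
Qed.

(** For each [s] the transfer from a basis vector to [s] is an intertwiner of [S], hence a scalar
    k(s): every u in the ideal satisfies u s = k(s) u b with b that basis vector. *)
Lemma rank_one_acts (S : rep A) : absolutely_irreducible S ->
  exists (phi : {scalar S}) (s0 : S), phi s0 = 1 /\
    forall v, exists a, forall s, rep_act S a s = phi s *: v.
Proof.
case=> irrS endS; have [_ /negP S0 _] := irrS.
have dS : (0 < \dim {:S})%N by rewrite lt0n dimv_eq0; apply/negP.
have [i0 _] : exists i : 'I_(\dim {:S}), true by exists (Ordinal dS).
pose b := vbasis {:S}.
have fb : free b := basis_free (vbasisP {:S}).
have s0n : b`_i0 != 0 by rewrite (free_not0 fb) // memt_nth.
have [U minU Us] := minimal_ideal_acts s0n.
have [u0 u0U u0s] := orbit_surj minU irrS Us b`_i0.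
(* Since [u0] fixes the basis vector, u0 s = k(s) b, so this functional reads off k(s). *)
exists (coord b i0 \o rep_act S u0), b`_i0; split.
  by rewrite /= u0s coord_free ?eqxx.
move=> v; have [a aU av] := orbit_surj minU irrS Us v; exists a => s.
have [G Ghom GU] := orbit_transfer minU irrS Us s.
have /vlineP[k Gk] : G \in <[\1%VF]>%VS.
  by rewrite -endS; apply/end_algP => d; rewrite Ghom.
have ks u : u \in U -> rep_act S u s = k *: rep_act S u b`_i0.
  by move=> uU; rewrite -GU // Gk scale_lfunE id_lfunE.
by rewrite /= (ks a) // (ks u0) // u0s av linearZ /= coord_free // eqxx mulr1.
Qed.
End Semisimple.

(** * The action of the Casimir element on pairs of irreducible representations *)

Section TensorAction.
Variables (K : fieldType) (A : falgType K).

Lemma act_biend_is_linear (S : rep A) : linear (act_biend S).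
Proof. by move=> k a b; apply/val_inj; rewrite /= linearP. Qed.

Lemma tens_act_linearl (S T : rep A) b :
  linear (fun a => tens (act_biend S a) (act_biend T b)).
Proof. by move=> k a a'; rewrite act_biend_is_linear tensPl. Qed.

Lemma tens_act_linearr (S T : rep A) a :
  linear (fun b => tens (act_biend S a) (act_biend T b)).
Proof. by move=> k b b'; rewrite act_biend_is_linear tensPr. Qed.

Lemma tens_act_sum (S T : rep A) n (x y : 'I_n -> A) :
  tens_act S T (\sum_k tens (x k) (y k))
    = \sum_k tens (act_biend S (x k)) (act_biend T (y k)).
Proof.
by rewrite /tens_act tens_lift_sum // => ?;
   [apply: tens_act_linearl | apply: tens_act_linearr].
Qed.

Variables (lambda : {scalar A}) (n : nat) (x y : 'I_n -> A).
Hypothesis frob : frobenius_form lambda.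
Hypothesis casi : is_casimir lambda (\sum_k tens (x k) (y k)).

Lemma tens_act_casimir_neq (S T : rep A) :
    semisimple_alg A -> irreducible_rep S -> irreducible_rep T ->
  ~ rep_iso S T -> tens_act S T (\sum_k tens (x k) (y k)) = 0.
Proof.
move=> ssA irrS irrT nST.
have [e [eS eT]] := separating_element ssA irrS irrT nST.
rewrite tens_act_sum.
have actS a : act_biend S (e * a) = act_biend S a.
  by apply/val_inj; rewrite /= rep_actM eS comp_lfun1l.
have actT a : act_biend T (a * e) = 0.
  by apply/val_inj; rewrite /= rep_actM eT comp_lfun0r.
under eq_bigr => k _ do rewrite -actS.
rewrite (casimir_bilin_outer frob casi e (@tens_act_linearl S T)
  (@tens_act_linearr S T)).
rewrite big1 // => k _; rewrite actT.
by apply/matrixP => i j; rewrite !mxE linear0 mulr0.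
Qed.

Variable S : rep A.
Hypotheses (ssA : semisimple_alg A) (absS : absolutely_irreducible S).

(** This is c_{S,S} = kappa . swap applied to s (x) v, with [psi] contracting the second factor. *)
Lemma casimir_swapl : exists kappa : K, forall (psi : {scalar S}) s v,
  \sum_k psi (rep_act S (y k) v) *: rep_act S (x k) s = (kappa * psi s) *: v.
Proof.
have [phi [s0 [phi1 rank1]]] := rank_one_acts ssA absS.
(* [F] commutes with [A] by the inner sliding identity, so it is a scalar, and that scalar is
   [kappa]. *)
pose F s := \sum_k phi (rep_act S (x k) s) *: rep_act S (y k) s0.
have Flin : linear F.
  move=> a u v; rewrite /F scaler_sumr -big_split; apply: eq_bigr => k _ /=.
  by rewrite !linearP /= scalerDl scalerA.
pose FL := GRing.isLinear.Build K S S _ F Flin.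
pose Fl : {linear S -> S} := HB.pack F FL.
have FE s : linfun Fl s = F s by rewrite lfunE.
have /vlineP[kappa Fk] : linfun Fl \in <[\1%VF]>%VS.
  rewrite -absS.2; apply/end_algP => a; apply/lfunP => s.
  rewrite [LHS]comp_lfunE [RHS]comp_lfunE !FE /F linear_sum /=.
  pose B a b := phi (rep_act S a s) *: rep_act S b s0.
  have Bl b : linear (B^~ b).
    by move=> k u v; rewrite /B linearP add_lfunE scale_lfunE linearP /=
      scalerDl scalerA.
  have Br b : linear (B b).
    move=> k u v; rewrite /B linearP add_lfunE scale_lfunE scalerDr !scalerA.
    by rewrite mulrC.
  have := casimir_bilin_inner frob casi a Bl Br; rewrite /B => BE.
  transitivity (\sum_k phi (rep_act S (x k) s) *: rep_act S (a * y k) s0).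
    by apply: eq_bigr => k _; rewrite rep_actME linearZ.
  by rewrite -BE; apply: eq_bigr => k _; rewrite rep_actME.
exists kappa => psi s v.
(* [a] acts as phi(.) v and sends [s0] to [v]. Sliding it from y_k a to a x_k turns the sum into
   psi(F s) v. *)
have [a av] := rank1 v.
pose B b c := psi (rep_act S c s0) *: rep_act S b s.
have Bl b : linear (B^~ b).
  move=> k u w; rewrite /B linearP add_lfunE scale_lfunE scalerDr !scalerA.
  by rewrite mulrC.
have Br b : linear (B b).
  by move=> k u w; rewrite /B linearP add_lfunE scale_lfunE linearP /=
      scalerDl scalerA.
have := casimir_bilin_outer frob casi a Bl Br; rewrite /B => BE.
transitivity (\sum_k psi (rep_act S (y k * a) s0) *: rep_act S (x k) s).
  by apply: eq_bigr => k _; rewrite rep_actME av phi1 scale1r.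
rewrite -BE.
transitivity (psi (F s) *: v).
  rewrite /F linear_sum scaler_suml; apply: eq_bigr => k _.
  by rewrite rep_actME av scalerA linearZ /= mulrC.
by rewrite -FE Fk scale_lfunE id_lfunE linearZ.
Qed.

Section Swap.
Variable kappa : K.
Hypothesis swap : forall (psi : {scalar S}) s v,
  \sum_k psi (rep_act S (y k) v) *: rep_act S (x k) s = (kappa * psi s) *: v.

(** In coordinate i this is [swap] for the i-th coordinate functional with [psi] applied to it. *)
Lemma casimir_swapr (psi : {scalar S}) s v :
  \sum_k psi (rep_act S (x k) s) *: rep_act S (y k) v = (kappa * psi v) *: s.
Proof.
apply: coord_inj => i.
have /(congr1 psi) := swap (coord (vbasis {:S}) i) s v.
rewrite !linear_sum !linearZ /= => H.
rewrite -mulrA [psi v * _]mulrC mulrA -H; apply: eq_bigr => k _.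
by rewrite !linearZ /= mulrC.
Qed.

(** Expanding each y_k s in a basis turns the sum of x_k y_k s into one contraction per basis
    vector, each equal to kappa s by [swap]. *)
Lemma casimir_trace_swap :
  rep_act S (casimir_trace (\sum_k tens (x k) (y k)) 1)
    = (kappa * (\dim {:S})%:R) *: \1%VF.
Proof.
have fb := basis_free (vbasisP {:S}).
rewrite /casimir_trace tens_lift_sum => [|w k u v|v k u w]; last 2 first.
- by rewrite !mulr1 mulrDl scalerAl.
- by rewrite mulrDr scalerAr.
apply/lfunP => s; rewrite linear_sum sum_lfunE scale_lfunE id_lfunE.
transitivity (\sum_(i < \dim {:S}) \sum_k
    coord (vbasis {:S}) i (rep_act S (y k) s)
      *: rep_act S (x k) (vbasis {:S})`_i).
  rewrite exchange_big; apply: eq_bigr => k _.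
  rewrite mulr1 rep_actME {1}(coord_vbasis (memvf (rep_act S (y k) s))).
  by rewrite linear_sum; apply: eq_bigr => i _; rewrite linearZ.
under eq_bigr => i _ do rewrite swap /= coord_free // eqxx mulr1.
by rewrite sumr_const card_ord mulr_natr scalerMnl.
Qed.

(** Two exchanges cancel: [swap] evaluates the sum over k and leaves the flipped contraction,
    evaluated by [casimir_swapr]. *)
Lemma tens_act_casimir_sqr s v (psi : {scalar S}) :
  \sum_k \sum_l psi (rep_act S (y k * y l) v) *: rep_act S (x k * x l) s
    = (kappa ^+ 2 * psi v) *: s.
Proof.
rewrite exchange_big /=.
under eq_bigr => l _.
  under eq_bigr => k _ do rewrite !rep_actME.
  rewrite swap -scalerA.
  over.
by rewrite -scaler_sumr casimir_swapr scalerA mulrA.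
Qed.

End Swap.

(** Contractions against vectors and functionals of [S], used to test equality of tensors of
    operators. *)
Definition biend_eval (s v : S) (psi : {scalar S}) (f g : biend S) : S :=
  psi (vsval g v) *: vsval f s.

Lemma biend_eval_linearl s v psi g : linear ((biend_eval s v psi)^~ g).
Proof.
move=> k f f'; rewrite /biend_eval linearP add_lfunE scale_lfunE.
by rewrite scalerDr !scalerA mulrC.
Qed.

Lemma biend_eval_linearr s v psi f : linear (biend_eval s v psi f).
Proof.
move=> k g g'; rewrite /biend_eval linearP add_lfunE scale_lfunE linearP /=.
by rewrite scalerDl scalerA.
Qed.

(** Independence of a basis of [biend S] is used twice: varying [s] isolates the first factor, then
    varying [v] and the coordinate functional [psi] isolates the second. *)
Lemma biend_eval_inj (t : tensor (biend S) (biend S)) :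
  (forall s v psi, tens_lift (biend_eval s v psi) t = 0) -> t = 0.
Proof.
move=> t0; pose b := vbasis {:biend S}.
have fb : free b := basis_free (vbasisP {:biend S}).
apply/matrixP => i j; rewrite [RHS]mxE.
pose M : 'M[K]_(_, _) := t.
have gi0 : \sum_l M i l *: b`_l = 0.
  apply/val_inj/lfunP => v; rewrite [RHS]lfunE; apply: coord_inj => m.
  rewrite linear0; pose psi := coord (vbasis {:S}) m.
  have fi0 : \sum_k (\sum_l M k l * psi (vsval b`_l v)) *: b`_k = 0.
    apply/val_inj/lfunP => s; rewrite [RHS]lfunE -[RHS](t0 s v psi).
    rewrite linear_sum sum_lfunE; apply: eq_bigr => k _.
    rewrite linearZ scale_lfunE scaler_suml; apply: eq_bigr => l _.
    by rewrite /biend_eval scalerA.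
  have := congr1 (coord b i) fi0; rewrite coord_sum_free // linear0 => <-.
  rewrite linear_sum sum_lfunE linear_sum; apply: eq_bigr => l _.
  by rewrite linearZ scale_lfunE linearZ.
by have := congr1 (coord b j) gi0; rewrite coord_sum_free // linear0.
Qed.

Lemma casimir_sqr_sum :
  (\sum_k tens (x k) (y k)) ^+ 2
    = \sum_k \sum_l tens (x k * x l) (y k * y l) :> tensor A A.
Proof.
rewrite expr2 mulr_suml; apply: eq_bigr => k _; rewrite mulr_sumr.
by apply: eq_bigr => l _; apply: tens_mulE.
Qed.

Lemma casimir_abs_irr : exists2 g : K,
    rep_act S (casimir_trace (\sum_k tens (x k) (y k)) 1) = g *: \1%VF &
    (\dim {:S})%:R ^+ 2 *: tens_act S S ((\sum_k tens (x k) (y k)) ^+ 2)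
      = g ^+ 2 *: tens (biend_id S) (biend_id S).
Proof.
have [kappa swap] := casimir_swapl.
exists (kappa * (\dim {:S})%:R); first exact: casimir_trace_swap.
(* The factor (dim S)^2 is stripped from both sides rather than inverted, leaving c^2 = kappa^2 on S
   (x) S in any characteristic. *)
rewrite exprMn [kappa ^+ 2 * _]mulrC -[RHS]scalerA; congr (_ *: _).
apply/eqP; rewrite -subr_eq0; apply/eqP.
apply: biend_eval_inj => s v psi.
pose L : {linear tensor A A -> tensor (biend S) (biend S)} :=
  tens_lift (fun a b => tens (act_biend S a) (act_biend S b)).
pose E : {linear tensor (biend S) (biend S) -> S} :=
  tens_lift (biend_eval s v psi).
have E_tens f g : E (tens f g) = biend_eval s v psi f g.
  by apply: tens_lift_tens;
     [apply: biend_eval_linearl | apply: biend_eval_linearr].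
have L_tens a b : L (tens a b) = tens (act_biend S a) (act_biend S b).
  exact: tens_actE.
rewrite -[LHS]/(E (L _ - _)) casimir_sqr_sum; clearbody L E.
rewrite linearB linearZ E_tens.
apply/eqP; rewrite subr_eq0; apply/eqP.
transitivity ((kappa ^+ 2 * psi v) *: s).
  rewrite -(tens_act_casimir_sqr swap) !linear_sum; apply: eq_bigr => k _.
  by rewrite !linear_sum; apply: eq_bigr => l _; rewrite L_tens E_tens.
by rewrite -scalerA /biend_eval /= !id_lfunE.
Qed.

End TensorAction.

(** * Orthogonality and the square formula for the Casimir element *)

Theorem theorem5 (K : fieldType) (A : falgType K) (lambda : {scalar A})
    (c : tensor A A) (Irr : rep A -> Prop)
    (ssA : semisimple_alg A) (frob : frobenius_form lambda)
    (casi : is_casimir lambda c) (irrA : full_irr_set Irr) :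
  (forall S T : rep A, Irr S -> Irr T -> S <> T -> tens_act S T c = 0) /\
  (forall S : rep A, Irr S -> absolutely_irreducible S ->
     exists2 g : K,
       rep_act S (casimir_trace c 1) = g *: \1%VF &
       (\dim {:S})%:R ^+ 2 *: tens_act S S (c ^+ 2)
         = g ^+ 2 *: tens (biend_id S) (biend_id S)).
Proof.
have [irr_irr _ irr_eq] := irrA.
have [n [x [y cE]]] := tens_sumE c; rewrite {}cE in casi *.
split=> [S T IS IT neqST | S _ absS].
  apply: tens_act_casimir_neq frob casi _ _ ssA _ _ _; first exact: irr_irr.
    exact: irr_irr.
  by move=> /irr_eq eqST; apply/neqST/eqST.
exact: (casimir_abs_irr frob casi ssA absS).
Qed.
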